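(* Let $G = (P, \cdot_G)$ and $H = (Q, \cdot_H)$ with $P = X/E$, $Q = Y/F$ be groups hyperdefinable over $C$. Let $\pi$ be a left-$G$-invariant partial type concentrating on $G$ and type-definable over $C$. Let $f: P \to Q$ be a $C$-type-definable partial function defined on $\pi|_{C}$ and such that for all $a \models \pi|_{C}$, $b \models \pi|_{C, a}$ we have $f(a \cdot_G b) = f(a) \cdot_H f(b)$. Then there exists a unique type-definable over $C$ group homomorphism $f': G \to H$ that agrees with $f$ on realizations of $\pi|_{C}$. Moreover, if $f$ is injective on $\pi|_{C}(\mathbb{M})$, then $f'$ is also injective.
   Context: $\mathbb{M}$ is a monster model of a complete theory $T$; $C$ is a small set of (hyperimaginary) parameters. A hyperdefinable set over $C$ is $P=X/E$ with $X$ a non-empty $C$-type-definable set and $E$ a $C$-type-definable equivalence relation; its elements are hyperimaginaries. A partial type on $P$ over a (possibly large) set $\{b_i/F_i\}_i$ of hyperimaginaries is a partial type $\pi^*(x,(b_i)_i)$, where $\pi^*(x,(y_i)_i)$ is a partial type over $\emptyset$ that is $E$-invariant in $x$ and $F_i$-invariant in each $y_i$ and implies membership in $X$ and in the sorts of the $b_i$; $a/E$ realizes it if $a$ does. In the statement, $\pi$ is a partial type on $P$ over $\mathbb{M}^{\mathrm{heq}}$ ($\mathbb{M}$ together with all hyperimaginaries). Type-definable subsets of and (partial) functions between hyperdefinable sets are those given (via their graphs) by small partial types. $\pi$ is type-definable over $C$ if for every hyperdefinable sort $Q$ and small partial type $\gamma(x,y)$ on $P\times Q$ over $\emptyset$ the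 set $\{b\in Q:\pi(x)\vdash\gamma(x,b)\}$ is $C$-type-definable. $\pi|_B$ is the union of all $\gamma(x,m)$ with $m$ in $B$, $\gamma(x,y)$ a small partial type over $\emptyset$, and $\pi\vdash\gamma(x,m)$; $\pi|_B(\mathbb{M})$ is its set of realizations. A type-definable partial function $f$ with graph $\Gamma_f$ is defined on $\pi$ (or on $\pi|_C$) if $\pi(x)$ (resp. $\pi|_C(x)$) $\vdash\exists y\,\Gamma_f(x,y)$; $f_*\pi$ is the union of all small partial types $\gamma(y)$ with $\pi(x)\vdash\exists u(\Gamma_f(x,u)\wedge\gamma(u))$. A hyperdefinable group over $C$ is a hyperdefinable set over $C$ with a $C$-type-definable group operation. For $g\in G(\mathbb{M})$, $g\cdot\pi:=(t_g)_*\pi$ with $t_g(h)=g\cdot h$; $\pi$ is left-$G$-invariant if $g\cdot\pi=\pi$ for all $g\in G(\mathbb{M})$. *)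

(* Defs.v *)
From mathcomp Require Import all_boot.
From mathcomp Require Import boolp classical_sets functions cardinality.

Set Implicit Arguments.
Unset Strict Implicit.
Unset Printing Implicit Defensive.

Local Open Scope classical_set_scope.
Local Open Scope card_scope.

(* First-order logic. The free variables of a formula are indexed by an
   arbitrary type; a quantifier binds [None : option V]. *)

Record language := Language {
  fsym : Type; farity : fsym -> nat;
  rsym : Type; rarity : rsym -> nat }.

Inductive term (L : language) (V : Type) : Type :=
| tvar of V
| tapp (s : fsym L) of ('I_(farity s) -> term L V).

Inductive formula (L : language) (V : Type) : Type :=
| fbot
| feq of term L V & term L V
| frel (r : rsym L) of ('I_(rarity r) -> term L V)
| fimp of formula L V & formula L V
| fall of formula L (option V).

Arguments tvar {L V}.
Arguments tapp {L V}.
Arguments fbot {L V}.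
Arguments feq {L V}.
Arguments frel {L V}.
Arguments fimp {L V}.
Arguments fall {L V}.

Record structure (L : language) := Structure {
  univ :> Type;
  fint : forall s : fsym L, ('I_(farity s) -> univ) -> univ;
  rint : forall r : rsym L, ('I_(rarity r) -> univ) -> Prop }.

Arguments fint {L} _ s _ : rename.
Arguments rint {L} _ r _ : rename.

Fixpoint teval (L : language) (N : structure L) (V : Type) (a : V -> N)
    (t : term L V) : N :=
  match t with
  | tvar v => a v
  | tapp s ts => fint N s (fun i => teval a (ts i))
  end.

Fixpoint feval (L : language) (N : structure L) (V : Type)
    (phi : formula L V) : (V -> N) -> Prop :=
  match phi with
  | fbot => fun=> False
  | feq t u => fun a => teval a t = teval a u
  | frel r ts => fun a => rint N r (fun i => teval a (ts i))
  | fimp p q => fun a => feval p a -> feval q a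
  | fall p => fun a => forall x : N, feval p (fun o => oapp a x o)
  end.

Fixpoint trename (L : language) (V W : Type) (h : V -> W) (t : term L V) :
    term L W :=
  match t with
  | tvar v => tvar (h v)
  | tapp s ts => tapp s (fun i => trename h (ts i))
  end.

Fixpoint frename (L : language) (V : Type) (phi : formula L V) :
    forall W : Type, (V -> W) -> formula L W :=
  match phi with
  | fbot => fun _ _ => fbot
  | feq t u => fun _ h => feq (trename h t) (trename h u)
  | frel r ts => fun _ h => frel r (fun i => trename h (ts i))
  | fimp p q => fun _ h => fimp (frename p h) (frename q h)
  | fall p => fun _ h => fall (frename p (omap h))
  end.

Definition theory (L : language) := set (formula L void).

Definition model_of (L : language) (T : theory L) (N : structure L) :=
  forall phi, T phi -> feval (N := N) phi (of_void N).

Definition consequence (L : language) (T : theory L) (phi : formula L void) :=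
  forall N : structure L, model_of T N -> feval (N := N) phi (of_void N).

Definition complete (L : language) (T : theory L) :=
  (exists N, model_of T N) /\
  forall phi, consequence T phi \/ consequence T (fimp phi fbot).

Definition fork (A B X : Type) (f : A -> X) (g : B -> X) (s : A + B) : X :=
  match s with inl a => f a | inr b => g b end.

Definition sumap (A B A' B' : Type) (f : A -> A') (g : B -> B') :
    A + B -> A' + B' :=
  fork (inl \o f) (inr \o g).

(* |A| < |K|; the type [K] plays the role of the cardinal kappa. *)
Definition below (K T : Type) (A : set T) : Prop :=
  A #<= [set: K] /\ ~ ([set: K] #<= A).

Definition strong_limit (K : Type) : Prop :=
  below K [set: nat] /\
  forall I : Type, below K [set: I] -> below K [set: set I].

Definition sat (L : language) (N : structure L) (V : Type) (a : V -> N)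
    (p : set (formula L V)) : Prop :=
  forall phi, p phi -> feval phi a.

Definition saturated (L : language) (N : structure L) (K : Type) : Prop :=
  forall (V W : Type) (b : W -> N) (p : set (formula L (V + W))),
    below K [set: V] -> below K [set: W] ->
    (forall q, finite_set q -> q `<=` p -> exists a : V -> N, sat (fork a b) q) ->
    exists a : V -> N, sat (fork a b) p.

Definition automorphism (L : language) (N : structure L) (s : N -> N) : Prop :=
  [/\ bijective s,
      forall f x, s (fint N f x) = fint N f (s \o x)
    & forall r x, rint N r (s \o x) <-> rint N r x].

Definition strongly_homogeneous (L : language) (N : structure L) (K : Type) :=
  forall (W : Type) (a b : W -> N), below K [set: W] ->
    (forall phi, feval phi a <-> feval phi b) ->
    exists s, automorphism s /\ s \o a = b.

Record monster (L : language) (T : theory L) := Monster {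
  mstr :> structure L;
  mcard : Type;
  monster_model : model_of T mstr;
  monster_limit : strong_limit mcard;
  monster_fsym : below mcard [set: fsym L];
  monster_rsym : below mcard [set: rsym L];
  monster_saturated : saturated mstr mcard;
  monster_homogeneous : strongly_homogeneous mstr mcard }.

Section Types.

Context (L : language) (T : theory L) (M : monster T).

Definition small (I : Type) (A : set I) : Prop := below (mcard M) A.

(* Sets of formulas in the variables [V] with parameters in [M]. *)
Definition mtype (V : Type) := set (formula L (V + M)).

Definition real (V : Type) (a : V -> M) (p : mtype V) : Prop :=
  sat (fork a id) p.

Definition ren (V W : Type) (h : V -> W) (p : mtype V) : mtype W :=
  (fun phi => frename phi (sumap h id)) @` p.

(* p(x, b), for p(x, y) in the variables [V + W]. *)
Definition plug (V W : Type) (b : W -> M) (p : mtype (V + W)) : mtype V :=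
  (fun phi => frename phi (fork (sumap id b) inr)) @` p.

Definition consistent (V : Type) (p : mtype V) : Prop :=
  forall q, finite_set q -> q `<=` p -> exists a, real a q.

(* p(x) |- exists u, q(x, u). The types may be large, so this is entailment
   modulo the elementary diagram of [M], finite piece by finite piece, and not
   an inclusion between sets of realizations in [M]. *)
Definition entails_ex (V W : Type) (p : mtype V) (q : mtype (V + W)) : Prop :=
  forall q0, finite_set q0 -> q0 `<=` q ->
  exists p0, [/\ finite_set p0, p0 `<=` p &
    forall a : V -> M, real a p0 -> exists u : W -> M, real (fork a u) q0].

Definition entails (V : Type) (p q : mtype V) : Prop :=
  forall phi, q phi -> exists p0, [/\ finite_set p0, p0 `<=` p &
    forall a : V -> M, real a p0 -> feval phi (fork a id)].

(* The data X, E of a quotient X/E. *)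
Record quot := Quot {
  qvar : Type;
  qdom : mtype qvar;
  qeq : mtype (qvar + qvar) }.

Arguments qdom : clear implicits.
Arguments qeq : clear implicits.

Definition quot_equivalence (P : quot) : Prop :=
  [/\ forall a, real a (qdom P) -> real (fork a a) (qeq P),
      forall a b, real (fork a b) (qeq P) ->
        real a (qdom P) /\ real b (qdom P),
      forall a b, real (fork a b) (qeq P) -> real (fork b a) (qeq P)
    & forall a b c, real (fork a b) (qeq P) -> real (fork b c) (qeq P) ->
        real (fork a c) (qeq P)].

Definition quot_prod (P Q : quot) : quot :=
  @Quot (qvar P + qvar Q)
    (ren inl (qdom P) `|` ren inr (qdom Q))
    (ren (sumap inl inl) (qeq P) `|` ren (sumap inr inr) (qeq Q)).

(* The elements of X/E, as equivalence classes. *)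
Definition elt (P : quot) : Type :=
  {A : set (qvar P -> M) |
    exists a, real a (qdom P) /\ A = [set b | real (fork a b) (qeq P)]}.

Definition reps (P : quot) (m : elt P) : set (qvar P -> M) := sval m.

Definition realizes (P : quot) (m : elt P) (p : mtype (qvar P)) : Prop :=
  exists2 a, reps m a & real a p.

(* p is a partial type on P: it implies membership in X and is E-invariant.
   The parameters of p are in [M] itself, which is no restriction: once its
   parameters b_i are substituted, a partial type over hyperimaginaries b_i/F_i
   is one over the tuples b_i, and these are hyperimaginaries. *)
Definition type_on (P : quot) (p : mtype (qvar P)) : Prop :=
  entails p (qdom P) /\ entails (ren inl p `|` qeq P) (ren inr p).

Definition over0 (V : Type) (p : mtype V) : Prop :=
  exists g : set (formula L V), p = (fun phi => frename phi inl) @` g.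

Record hyperimaginary := Hyperimaginary {
  hsort : quot;
  hrep : qvar hsort -> M;
  hsort_small : small [set: qvar hsort];
  hsort_dom : over0 (qdom hsort);
  hsort_eq : over0 (qeq hsort);
  hsort_equivalence : quot_equivalence hsort;
  hrep_dom : real hrep (qdom hsort) }.

Arguments hrep : clear implicits.

(* A small set of hyperimaginaries. Smallness is asked of the concatenation of
   the representatives, so kappa need not be regular. *)
Record params := Params {
  pidx : Type;
  pelt : pidx -> hyperimaginary;
  pidx_small : small [set: pidx];
  pelt_small : small [set: {i : pidx & qvar (hsort (pelt i))}] }.

Definition pvar (C : params) : Type := {i : pidx C & qvar (hsort (pelt i))}.

Definition ptuple (C : params) (v : pvar C) : M := hrep (pelt (tag v)) (tagged v).

Definition pcoord (C : params) (y : pvar C -> M) (i : pidx C) :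
    qvar (hsort (pelt i)) -> M :=
  fun v => y (Tagged (fun j => qvar (hsort (@pelt C j))) v).

Arguments pcoord {C} y i v.

(* p = g(x, (c_i)_i), where g(x, (y_i)_i) is a partial type over the empty set
   that implies membership of each y_i in its sort and is F_i-invariant in
   each y_i. *)
Definition over (C : params) (V : Type) (p : mtype V) : Prop :=
  exists g : set (formula L (V + pvar C)),
    [/\ forall x y, sat (fork x y) g ->
          forall i, real (pcoord y i) (qdom (hsort (pelt i))),
        forall x y y',
          (forall i, real (fork (pcoord y i) (pcoord y' i))
                          (qeq (hsort (pelt i)))) ->
          sat (fork x y) g -> sat (fork x y') g
      & p = (fun phi => frename phi (sumap id (@ptuple C))) @` g].

Definition type_definable (C : params) (V : Type) (A : set (V -> M)) : Prop :=
  exists p, over C p /\ A = [set a | real a p].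

(* P = X/E is a hyperdefinable set over C. *)
Definition hyperdefinable (C : params) (P : quot) : Prop :=
  [/\ small [set: qvar P], over C (qdom P), over C (qeq P),
      exists a, real a (qdom P) & quot_equivalence P].

(* G defines the partial function f : P -> Q. *)
Definition graph_of (P Q : quot) (f : elt P -> option (elt Q))
    (G : mtype (qvar P + qvar Q)) : Prop :=
  forall a b, real (fork a b) G <->
    exists m n, [/\ reps m a, reps n b & f m = Some n].

Definition type_definable_fun (C : params) (P Q : quot)
    (f : elt P -> option (elt Q)) : Prop :=
  exists G, over C G /\ graph_of f G.

Definition defined_on (P Q : quot) (f : elt P -> option (elt Q))
    (p : mtype (qvar P)) : Prop :=
  exists G, [/\ small G, graph_of f G & entails_ex p G].

Definition pushforward (P Q : quot) (f : elt P -> option (elt Q))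
    (p : mtype (qvar P)) : mtype (qvar Q) :=
  [set phi | exists (G : mtype (qvar P + qvar Q)) (g : mtype (qvar Q)),
    [/\ small G, graph_of f G, small g, type_on g &
      entails_ex p (G `|` ren inr g) /\ g phi]].

(* {b in Q : p(x) |- g(x, b)} is C-type-definable. The elements of C are
   treated as constants here and in [restr], [restr1]: the types g are over C
   rather than over the empty set, as X and E themselves need parameters in C.
   A type over C in small tuples of variables is automatically small. *)
Definition type_definable_type (C : params) (P : quot) (p : mtype (qvar P)) :
    Prop :=
  forall (Q : quot) (g : mtype (qvar P + qvar Q)),
    hyperdefinable C Q -> over C g -> @type_on (quot_prod P Q) g ->
    type_definable C [set b | real b (qdom Q) /\ entails p (plug b g)].

(* p|_C *)
Definition restr (C : params) (P : quot) (p : mtype (qvar P)) :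
    mtype (qvar P) :=
  [set phi | exists g, [/\ over C g, type_on g, entails p g & g phi]].

(* p|_{C, m} *)
Definition restr1 (C : params) (P Q : quot) (p : mtype (qvar P)) (m : elt Q) :
    mtype (qvar P) :=
  [set phi | exists (g : mtype (qvar P + qvar Q)) (b : qvar Q -> M),
    [/\ over C g, @type_on (quot_prod P Q) g, reps m b,
        entails p (plug b g) & plug b g phi]].

Definition group_law (X : Type) (op : X -> X -> X) : Prop :=
  associative op /\
  exists e inv, [/\ left_id e op, right_id e op,
                    left_inverse e inv op & right_inverse e inv op].

Definition hyperdefinable_group (C : params) (P : quot)
    (op : elt P -> elt P -> elt P) : Prop :=
  [/\ hyperdefinable C P, group_law op &
    type_definable C [set abc : qvar P + qvar P + qvar P -> M |
      exists m n, [/\ reps m (abc \o inl \o inl), reps n (abc \o inl \o inr)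
                    & reps (op m n) (abc \o inr)]]].

(* g . p = p for all g, equality of partial types being equivalence. *)
Definition left_invariant (P : quot) (op : elt P -> elt P -> elt P)
    (p : mtype (qvar P)) : Prop :=
  forall g : elt P,
    entails (pushforward (fun h => Some (op g h)) p) p /\
    entails p (pushforward (fun h => Some (op g h)) p).

End Types.

(* Main.v *)
Require Import Defs.
From mathcomp Require Import all_boot.
From mathcomp Require Import boolp classical_sets functions cardinality.

(** Why the theorem holds. Say that a property of points of G holds generically
    if, for some small tuple c of parameters, every d satisfying all
    consequences of pi over c has it. Generic properties form a proper filter
    (pi is consistent and the monster saturated), which contains the set S of
    realizations of pi|_C and, for each m, the set of realizations of pi|_(C,m).
    Left invariance of pi makes the filter left invariant. So for every g there
    is d with d and gd both in S, whence G = S S^-1, and the homomorphism can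
    only be f'(g) = f(gd) f(d)^-1.

    Independence of the choice of d is the one real point. Suppose that a, ga,
    a', ga' lie in S and choose d generic, with x = a^-1 a' and e = x d. By left
    invariance e is generic too, and a e = a' d, ga e = ga' d. Applying f to
    these two equations, f(a) f(e) = f(a') f(d) and f(ga) f(e) = f(ga') f(d);
    eliminating f(e) and f(d) gives f(ga) f(a)^-1 = f(ga') f(a')^-1. The
    homomorphism law, uniqueness and injectivity follow by picking a point
    generic enough for the finitely many elements involved. This group theory is
    carried out for an abstract left-invariant filter ([generic_morphism],
    [morphism_determined], [morphism_injective]).

    The model theory has three parts. First, [generic_extend]: a generic point
    over c can be moved, within its type over c, to a generic point over more
    parameters. It is what makes the filter left invariant
    ([generic_translate]): the hypothesis that the pushforward of pi entails pi
    only says, formula by formula, that phi holds at g d for d generic over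
    some parameters depending on phi; [generic_extend] brings these back to the
    parameters of phi, of g and of C, uniformly in phi. Secondly, [type_ex]:
    projections of sets given by small types are given by small types, so that
    the graph of f', a projection of an intersection of type-definable sets, is
    type-definable over C ([quotient_graph_type_definable]). Thirdly, enough
    cardinal arithmetic below a strong limit to know that tuples of parameters
    can be concatenated and collected from small sets of formulas. *)

Set Implicit Arguments.
Unset Strict Implicit.
Unset Printing Implicit Defensive.

Local Open Scope classical_set_scope.
Local Open Scope card_scope.

Arguments qdom {L T M} q.
Arguments qeq {L T M} q.
Arguments pcoord {L T M C} y i v.

(** * Cardinals below a strong limit *)

Lemma card_le_inj (A B : Type) (f : A -> B) :
  injective f -> [set: A] #<= [set: B].
Proof.
move=> fI; have [|g] := (@injfunPex _ _ [set: A] [set: B]).2.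
  by exists f => // x y _ _; exact: fI.
exact: inj_card_le g.
Qed.

Lemma below_inj (K A B : Type) (f : A -> B) :
  injective f -> below K [set: B] -> below K [set: A].
Proof.
move=> /card_le_inj AB [BK KB]; split; first exact: card_le_trans BK.
by move=> KA; apply: KB; apply: card_le_trans AB.
Qed.

Definition partial_bij (A B : Type) (R : set (A * B)) : Prop :=
  (forall a b b', R (a, b) -> R (a, b') -> b = b') /\
  (forall a a' b, R (a, b) -> R (a', b) -> a = a').

(** Comparability of cardinals: a maximal partial bijection, which exists by
    Zorn's lemma, is total on one of the two sides. *)
Lemma injections_comparable (A B : Type) :
  (exists f : A -> B, injective f) \/ (exists f : B -> A, injective f).
Proof.
have [|R [[Rf Ri] Rmax]] := @Zorn_bigcup (A * B) (@partial_bij A B).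
  move=> F FP Ftot; split=> [a b b'|a a' b] [X FX Xab] [Y FY Yab].
    have [XY|YX] := Ftot X Y FX FY.
      exact: (FP Y FY).1 (XY _ Xab) Yab.
    exact: (FP X FX).1 Xab (YX _ Yab).
  have [XY|YX] := Ftot X Y FX FY.
    exact: (FP Y FY).2 (XY _ Xab) Yab.
  exact: (FP X FX).2 Xab (YX _ Yab).
have [tot|/existsNP[a aN]] := pselect (forall a, exists b, R (a, b)).
  left; have [f fR] := choice tot.
  by exists f => x y fxy; apply: Ri (fR x) _; rewrite fxy.
have [sur|/existsNP[b bN]] := pselect (forall b, exists a, R (a, b)).
  right; have [f fR] := choice sur.
  by exists f => x y fxy; apply: Rf (fR x) _; rewrite fxy.
(* Otherwise some (a, b) can be added to R. *)
exfalso; have : ~ partial_bij (R `|` [set (a, b)]).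
  move: Rmax => /(_ (R `|` [set (a, b)])); apply.
  split; first by move=> x; left.
  by move=> /(_ (a, b) (or_intror erefl)) Rab; apply: aN; exists b.
apply; split=> [x y y'|x x' y] [Rxy|[]].
- by case=> [|[xa _]]; [exact: Rf | case: aN; exists y; rewrite -xa].
- by move=> -> -> [Ray|[//]]; case: aN; exists y'.
- by case=> [|[_ yb]]; [exact: Ri | case: bN; exists x; rewrite -yb].
- by move=> -> -> [Ray|[//]]; case: bN; exists x'.
Qed.

(** If A injects into B, then A + B injects into the second power set of B,
    which is still below a strong limit. *)
Lemma below_sum (K A B : Type) : strong_limit K ->
  below K [set: A] -> below K [set: B] -> below K [set: A + B].
Proof.
move=> [_ Kpow]; wlog [f fI] : A B / exists f : A -> B, injective f.
  move=> IH KA KB; have [fI|fI] := injections_comparable A B; first exact: IH.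
  have := IH B A fI KB KA.
  apply: (@below_inj _ _ _ (fun s => match s with inl a => inr a | inr b => inl b end)).
  by move=> [x|x] [y|y] // [->].
move=> _ KB.
(* Singletons code B, and pairs with the empty set code A. *)
pose g (s : A + B) : set (set B) :=
  match s with inl a => [set [set f a]; set0] | inr b => [set [set b]] end.
have set1N0 b : [set b] <> set0 :> set B by move=> /seteqP[/(_ b erefl)].
have set1I (U : Type) (x y : U) : [set x] = [set y] -> x = y.
  by move=> /seteqP[/(_ x erefl)].
apply: (@below_inj _ _ _ g) (Kpow _ (Kpow _ KB)) => -[x|x] [y|y] //= gxy.
- congr inl; apply: fI; have : g (inl y) [set f x] by rewrite /g -gxy; left.
  by case=> [fxy|/set1N0 //]; exact: set1I fxy.
- have : [set [set y]] (@set0 B) by rewrite -gxy; right.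
  by move=> /esym/set1N0.
- have : [set [set x]] (@set0 B) by rewrite gxy; right.
  by move=> /esym/set1N0.
- by congr inr; apply/set1I/set1I.
Qed.

Lemma below_prod (K A B : Type) : strong_limit K ->
  below K [set: A] -> below K [set: B] -> below K [set: A * B].
Proof.
move=> Klim KA KB; pose g (p : A * B) : set (A + B) := [set inl p.1; inr p.2].
apply: (@below_inj _ _ _ g) (Klim.2 _ (below_sum Klim KA KB)).
move=> [a b] [a' b'] gE.
have [[->]|//] : g (a', b') (inl a) by rewrite -gE; left.
by have [//|[->]] : g (a', b') (inr b) by rewrite -gE; right.
Qed.

(** * Formulas: renaming, support and quantification over tuples *)

Lemma finite_set_seq (X : Type) (A : set X) :
  finite_set A -> exists s : seq {classic X}, A = [set` s].
Proof. by case/(@finite_seqP {classic X}) => s ->; exists s. Qed.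

Lemma fork_sumap (A B A' B' X : Type) (f : A' -> X) (g : B' -> X)
    (h : A -> A') (k : B -> B') :
  fork f g \o sumap h k = fork (f \o h) (g \o k).
Proof. by apply/funext => -[]. Qed.

Lemma comp_fork (A B X Y : Type) (f : A -> X) (g : B -> X) (h : X -> Y) :
  h \o fork f g = fork (h \o f) (h \o g).
Proof. by apply/funext => -[]. Qed.

Lemma fork_eta (A B X : Type) (f : A + B -> X) : fork (f \o inl) (f \o inr) = f.
Proof. by apply/funext => -[]. Qed.

Definition rotate (V U W : Type) : (V + U) + W -> U + (V + W) :=
  fork (fork (inr \o inl) inl) (inr \o inr).

Lemma fork_rotate (V U W X : Type) (x : V -> X) (u : U -> X) (w : W -> X) :
  fork u (fork x w) \o @rotate V U W = fork (fork x u) w.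
Proof. by apply/funext => -[[]|]. Qed.

Section Syntax.
Context (L : language).

(** Variables are listed in [{classic V}], which carries a decidable equality
    for an arbitrary type V. *)
Fixpoint tvars (V : Type) (t : term L V) : seq {classic V} :=
  match t with
  | tvar v => [:: v : {classic V}]
  | tapp s ts => flatten [seq tvars (ts i) | i <- enum 'I_(farity s)]
  end.

Fixpoint fvars (V : Type) (phi : formula L V) : seq {classic V} :=
  match phi with
  | fbot => [::]
  | feq t u => tvars t ++ tvars u
  | Defs.frel r ts => flatten [seq tvars (ts i) | i <- enum 'I_(rarity r)]
  | fimp p q => fvars p ++ fvars q
  | fall p => pmap id (fvars p : seq (option {classic V}))
  end.

Lemma mem_flatten_ord (X : eqType) n (F : 'I_n -> seq X) i x :
  x \in F i -> x \in flatten [seq F j | j <- enum 'I_n].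
Proof. by move=> xF; apply/flatten_mapP; exists i; rewrite ?mem_enum. Qed.

Lemma mem_pmap_id (V : Type) (l : seq {classic option V}) (v : V) :
  (Some v : {classic option V}) \in l ->
  (v : {classic V}) \in pmap id (l : seq (option {classic V})).
Proof.
elim: l => //= o l IH; rewrite in_cons => /orP[/eqP<-|/IH vl] /=.
  exact: mem_head.
by case: o => [w|] //=; rewrite in_cons vl orbT.
Qed.

Lemma trename_ext (V W : Type) (h h' : V -> W) (t : term L V) :
  (forall v : {classic V}, v \in tvars t -> h v = h' v) ->
  trename h t = trename h' t.
Proof.
elim: t => [v|s ts IH] /= hh'; first by rewrite hh' ?mem_seq1.
congr tapp; apply/funext => i; apply: IH => v vi; apply: hh'.
exact: mem_flatten_ord vi.
Qed.

Lemma frename_ext (V W : Type) (phi : formula L V) (h h' : V -> W) :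
  (forall v : {classic V}, v \in fvars phi -> h v = h' v) ->
  frename phi h = frename phi h'.
Proof.
elim: phi W h h' => {V} [V|V t u|V r ts|V p IHp q IHq|V p IH] W h h' /= hh' //.
- by congr feq; apply: trename_ext => v vt; apply: hh'; rewrite mem_cat vt ?orbT.
- congr Defs.frel; apply/funext => i; apply: trename_ext => v vi.
  by apply: hh'; apply: mem_flatten_ord vi.
- by congr fimp; [apply: IHp|apply: IHq] => v vt; apply: hh';
    rewrite mem_cat vt ?orbT.
- congr (fall _); apply: IH => -[v|] vp //=; congr Some; apply: hh'.
  exact: mem_pmap_id vp.
Qed.

Lemma trename_id (V : Type) (t : term L V) : trename id t = t.
Proof. by elim: t => //= s ts IH; congr tapp; apply/funext. Qed.

Lemma frename_id (V : Type) (phi : formula L V) : frename phi id = phi.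
Proof.
elim: phi => {V} [V|V t u|V r ts|V p IHp q IHq|V p IH] //=.
- by rewrite !trename_id.
- by congr Defs.frel; apply/funext => i; rewrite trename_id.
- by rewrite IHp IHq.
- by rewrite (_ : omap id = id) ?IH //; apply/funext => -[].
Qed.

Lemma trename_comp (V W X : Type) (h : V -> W) (k : W -> X) (t : term L V) :
  trename k (trename h t) = trename (k \o h) t.
Proof. by elim: t => //= s ts IH; congr tapp; apply/funext. Qed.

Lemma frename_comp (V : Type) (phi : formula L V) (W X : Type)
    (h : V -> W) (k : W -> X) :
  frename (frename phi h) k = frename phi (k \o h).
Proof.
elim: phi W X h k => {V} [V|V t u|V r ts|V p IHp q IHq|V p IH] W X h k //=.
- by rewrite !trename_comp.
- by congr Defs.frel; apply/funext => i; rewrite trename_comp.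
- by rewrite IHp IHq.
- by rewrite IH; congr (fall (frename p _)); apply/funext => -[].
Qed.

Context (N : structure L).

Lemma teval_rename (V W : Type) (h : V -> W) (a : W -> N) (t : term L V) :
  teval a (trename h t) = teval (a \o h) t.
Proof. by elim: t => //= s ts IH; congr fint; apply/funext. Qed.

Lemma feval_rename (V : Type) (phi : formula L V) (W : Type)
    (h : V -> W) (a : W -> N) :
  feval (frename phi h) a = feval phi (a \o h).
Proof.
elim: phi W h a => {V} [V|V t u|V r ts|V p IHp q IHq|V p IH] W h a //=.
- by rewrite !teval_rename.
- by congr rint; apply/funext => i; rewrite teval_rename.
- by rewrite IHp IHq.
- apply/eq_forall => x; rewrite IH; congr (feval p _).
  by apply/funext => -[].
Qed.

Lemma feval_ext (V : Type) (phi : formula L V) (a b : V -> N) :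
  (forall v : {classic V}, v \in fvars phi -> a v = b v) ->
  feval phi a = feval phi b.
Proof.
have text (W : Type) (t : term L W) (c d : W -> N) :
    (forall v : {classic W}, v \in tvars t -> c v = d v) ->
    teval c t = teval d t.
  elim: t => [v|s ts IH] /= cd; first by rewrite cd ?mem_seq1.
  congr fint; apply/funext => i; apply: IH => v vi; apply: cd.
  exact: mem_flatten_ord vi.
elim: phi a b => {V} [V|V t u|V r ts|V p IHp q IHq|V p IH] a b /= ab //.
- rewrite (text _ t a b) 1?(text _ u a b) // => v vt; apply: ab;
    by rewrite mem_cat vt ?orbT.
- congr rint; apply/funext => i; apply: text => v vi.
  by apply: ab; apply: mem_flatten_ord vi.
- rewrite (IHp a b) 1?(IHq a b) // => v vt; apply: ab;
    by rewrite mem_cat vt ?orbT.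
- apply/eq_forall => x; apply: IH => -[v|] //= vp; apply: ab.
  exact: mem_pmap_id vp.
Qed.

Lemma sat_setU (V : Type) (p q : set (formula L V)) (a : V -> N) :
  sat a (p `|` q) <-> sat a p /\ sat a q.
Proof.
split=> [pq|[ap aq] phi [/ap|/aq] //].
by split=> phi phip; apply: pq; [left | right].
Qed.

Lemma sat_rename (V W : Type) (h : V -> W) (p : set (formula L V)) (a : W -> N) :
  sat a [set frename phi h | phi in p] <-> sat (a \o h) p.
Proof.
split=> [ap phi phip|ap _ [phi phip <-]]; last by rewrite feval_rename; apply: ap.
by rewrite -feval_rename; exact: ap _ (imageP _ phip).
Qed.

Definition fneg (V : Type) (phi : formula L V) := fimp phi fbot.
Definition fand (V : Type) (phi psi : formula L V) :=
  fneg (fimp phi (fneg psi)).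
Definition fconj (V : Type) (s : seq (formula L V)) : formula L V :=
  foldr (@fand V) (fneg fbot) s.
Definition fex (V : Type) (phi : formula L (option V)) : formula L V :=
  fneg (fall (fneg phi)).

Lemma feval_fneg (V : Type) (phi : formula L V) (a : V -> N) :
  feval (fneg phi) a = ~ feval phi a.
Proof. by []. Qed.

Lemma feval_fand (V : Type) (phi psi : formula L V) (a : V -> N) :
  feval (fand phi psi) a <-> feval phi a /\ feval psi a.
Proof.
split=> [/= h|[hp hq] /=]; last by apply.
by split; apply: contrapT => nh; apply: h.
Qed.

Lemma feval_fconj (V : Type) (s : seq {classic formula L V}) (a : V -> N) :
  feval (fconj s) a <-> sat a [set` s].
Proof.
elim: s => [|phi s IH]; first by split=> // _ psi.
rewrite -[fconj _]/(fand phi (fconj s)) feval_fand IH; split.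
  by move=> [hphi hs] psi; rewrite /= in_cons => /orP[/eqP->|/hs].
move=> h; split=> [|psi ps]; first by apply: h; rewrite /= mem_head.
by apply: h; rewrite /= in_cons; apply/orP; right.
Qed.

Lemma feval_fex (V : Type) (phi : formula L (option V)) (a : V -> N) :
  feval (fex phi) a <-> exists x : N, feval phi (fun o => oapp a x o).
Proof.
split=> /= [h|[x hx] h]; last exact: h hx.
by apply: contrapT => /forallNP nh; apply: h => x; apply: nh.
Qed.

(** Only finitely many variables of U occur in phi, and they are quantified one
    after the other. Other variables of U may then be given any value. *)
Lemma fex_tuple (U V : Type) (phi : formula L (U + V)) :
  exists psi : formula L V, forall a : V -> N,
    feval psi a <-> exists u : U -> N, feval phi (fork u a).
Proof.
have [[N0 _]|N0] := pselect (exists x : N, True); last first.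
  (* In an empty structure, U has a valuation only if it is empty. *)
  have [[x0 _]|U0] := pselect (exists x : U, True).
    by exists fbot => a; split=> // -[u _]; apply: N0; exists (u x0).
  have k (x : U) : V by exfalso; apply: U0; exists x.
  exists (frename phi (fork k id)) => a; rewrite feval_rename comp_fork.
  have kE (u : U -> N) : a \o k = u.
    by apply/funext => x; exfalso; apply: U0; exists x.
  by split=> [h|[u]]; [exists (a \o k) | rewrite -(kE u)].
pose upd (u u' : U -> N) (l : seq {classic U + V}) (x : U) :=
  if (inl x : {classic U + V}) \in l then u' x else u x.
(* psi still mentions U, but its truth no longer depends on the values there. *)
have [psi psiP] : exists psi : formula L (U + V), forall a u,
    feval psi (fork u a) <-> exists u', feval phi (fork (upd u u' (fvars phi)) a).
  elim: (fvars phi) => [|d l [psi psiP]].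
    by exists phi => a u; split=> [h|[]]; first by exists u.
  case: d => [x|v]; last first.
    exists psi => a u; rewrite psiP.
    have updE u' : upd u u' (inr v :: l) = upd u u' l.
      by apply/funext => y; rewrite /upd in_cons; case: eqP.
    by split=> -[u' h]; exists u'; move: h; rewrite updE.
  pose h (w : U + V) : option (U + V) :=
    if (w : {classic U + V}) == inl x then None else Some w.
  exists (fex (frename psi h)) => a u; rewrite feval_fex.
  have inlE z : ((inl z : {classic U + V}) == inl x) = ((z : {classic U}) == x).
    by apply/eqP/eqP => [[]|->].
  have hE y : (fun o => oapp (fork u a) y o) \o h =
      fork (fun z => if (z : {classic U}) == x then y else u z) a.
    by apply/funext => -[z|v]; rewrite /= /h ?inlE; case: eqP.
  split=> [[y]|[u' hu']].
    rewrite feval_rename hE psiP => -[u' hu'].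
    exists (fun z => if (inl z : {classic U + V}) \in l then u' z else y).
    move: hu'; congr (feval phi (fork _ a)); apply/funext => z.
    rewrite /upd in_cons inlE; case: ifP => zl; first by rewrite orbT.
    by rewrite orbF; case: eqP.
  exists (u' x); rewrite feval_rename hE psiP; exists u'.
  move: hu'; congr (feval phi (fork _ a)); apply/funext => z.
  by rewrite /upd in_cons inlE; case: eqP => [->|_] /=; case: ifP.
(* The variables of U left in psi all become one more bound variable. *)
exists (fex (frename psi (fork (fun=> None) some))) => a; rewrite feval_fex.
have phiE u' u : feval phi (fork (upd u u' (fvars phi)) a) =
                 feval phi (fork u' a).
  by apply: feval_ext => -[z|//] zphi /=; rewrite /upd zphi.
split=> [[y]|[u hu]].
  rewrite feval_rename comp_fork psiP => -[u' hu']; exists u'.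
  by rewrite -(phiE _ (fun=> y)).
by exists N0; rewrite feval_rename comp_fork psiP; exists u; rewrite phiE.
Qed.

End Syntax.

(** * Saturation and entailment *)

Section Monster.
Context (L : language) (T : theory L) (M : monster T).

Definition small_type (I : Type) : Prop := small M [set: I].

Lemma small_sum (A B : Type) :
  small_type A -> small_type B -> small_type (A + B).
Proof. exact: below_sum (monster_limit M). Qed.

Lemma small_void : small_type void.
Proof.
by apply: (@below_inj _ _ _ (of_void nat)) (monster_limit M).1 => -[].
Qed.

Definition inst (V W : Type) (c : W -> M) (phi : formula L (V + W)) :
  formula L (V + M) := frename phi (sumap id c).

Lemma feval_inst (V W : Type) (c : W -> M) (phi : formula L (V + W)) a :
  feval (inst c phi) (fork a id) = feval phi (fork a c).
Proof. by rewrite feval_rename fork_sumap. Qed.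

Lemma inst_comp (V W W' : Type) (c : W -> M) (h : W' -> W)
    (phi : formula L (V + W')) :
  inst (c \o h) phi = inst c (frename phi (sumap id h)).
Proof. by rewrite /inst frename_comp /sumap comp_fork. Qed.

Lemma real_inst (V W : Type) (c : W -> M) (h : set (formula L (V + W))) a :
  real a (inst c @` h) <-> sat (fork a c) h.
Proof. by rewrite -(fork_sumap a id id c) -sat_rename. Qed.

Lemma real_ren (V W : Type) (h : V -> W) (p : mtype M V) a :
  real a (ren h p) <-> real (a \o h) p.
Proof. by rewrite /real -(fork_sumap a id h id) -sat_rename. Qed.

Lemma real_plug (V W : Type) (b : W -> M) (p : mtype M (V + W)) a :
  real a (plug b p) <-> real (fork a b) p.
Proof.
rewrite /real sat_rename; suff -> : fork a id \o fork (sumap id b) inr =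
  fork (fork a b) (id : M -> M) by [].
by apply/funext => -[[]|].
Qed.

Lemma realize (V W : Type) (c : W -> M) (p : set (formula L (V + W))) :
  small_type V -> small_type W ->
  (forall s : seq {classic formula L (V + W)}, [set` s] `<=` p ->
     exists a : V -> M, feval (fconj s) (fork a c)) ->
  exists a : V -> M, sat (fork a c) p.
Proof.
move=> sV sW fin; apply: (monster_saturated sV sW) => q /finite_set_seq[s ->] sp.
by have [a] := fin s sp; rewrite feval_fconj => ha; exists a.
Qed.

(** By saturation, [exists u, g(u, w)] amounts to all formulas equivalent to
    [exists u, g0(u, w)] for a finite part g0 of g. *)
Lemma type_ex (U W : Type) (g : set (formula L (U + W))) :
  small_type U -> small_type W ->
  exists k : set (formula L W), forall w : W -> M,
    sat w k <-> exists u : U -> M, sat (fork u w) g.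
Proof.
move=> sU sW; exists [set psi | exists s : seq {classic formula L (U + W)},
  [set` s] `<=` g /\ forall w : W -> M,
    feval psi w <-> exists u : U -> M, feval (fconj s) (fork u w)].
move=> w; split=> [wk|[u ug] psi [s [sg sE]]]; last first.
  by apply/sE; exists u; rewrite feval_fconj => phi /sg; exact: ug.
apply: realize => // s sg; have [psi psiP] := fex_tuple M (fconj s).
by apply/psiP; apply: wk; exists s.
Qed.

(** The parameters of a small set of formulas form a small tuple: list those of
    each formula. *)
Lemma small_params (V : Type) (q : mtype M V) : small M q ->
  exists (W : Type) (c : W -> M), small_type W /\ q `<=` range (inst c).
Proof.
move=> sq; have [[m0 _]|M0] := pselect (exists m : M, True); last first.
  exists M, id; split=> [|phi _].
    apply: (@below_inj _ _ _ (fun=> 0)) (monster_limit M).1 => m.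
    by exfalso; apply: M0; exists m.
  exists phi => //; rewrite -[RHS]frename_id; congr frename.
  by apply/funext => -[].
pose vals (phi : formula L (V + M)) : seq {classic M} :=
  pmap (fun w => match w with inl _ => None | inr m => Some (m : {classic M}) end)
       (fvars phi : seq (V + M)).
exists (set_type q * nat)%type, (fun w => nth m0 (vals (val w.1)) w.2); split.
  apply: below_prod; [exact: (monster_limit M)| |exact: (monster_limit M).1].
  rewrite /below (card_le_eql (card_setT q)); split; first exact: sq.1.
  by rewrite (card_le_eqr (card_setT q)); exact: sq.2.
move=> phi qphi; pose k : set_type q := SigSub (mem_set qphi).
exists (frename phi (sumap id (fun m => (k, index (m : {classic M}) (vals phi))))) => //.
rewrite /inst frename_comp -[RHS]frename_id; apply: frename_ext => -[v|m] //= mphi.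
congr inr; apply: (@nth_index {classic M}); rewrite /vals.
elim: (fvars phi) mphi => //= w l IH; rewrite in_cons => /orP[/eqP<-|/IH ml] /=.
  exact: mem_head.
by case: w => //= m'; rewrite in_cons ml orbT.
Qed.

Lemma entails_real (V : Type) (p q : mtype M V) a :
  entails p q -> real a p -> real a q.
Proof.
by move=> pq ap phi /pq[p0 [_ p0p]]; apply => psi /p0p; apply: ap.
Qed.

(** * Generic points of a large type *)

Section Generic.
Context (V : Type) (p : mtype M V).

Lemma entails1 (phi : formula L (V + M)) :
  entails p [set phi] <-> exists p0, [/\ finite_set p0, p0 `<=` p &
    forall a : V -> M, real a p0 -> feval phi (fork a id)].
Proof. by split=> [/(_ phi erefl)|h _ ->]. Qed.

Lemma entails_seq (W : Type) (s : seq {classic W})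
    (R : W -> (V -> M) -> Prop) :
  (forall w, [set` s] w -> exists p0, [/\ finite_set p0, p0 `<=` p &
     forall a, real a p0 -> R w a]) ->
  exists p0, [/\ finite_set p0, p0 `<=` p & forall a, real a p0 ->
     forall w, [set` s] w -> R w a].
Proof.
elim: s => [|w s IH] h; first by exists set0; split.
have [|p0 [p0f p0p p0R]] := IH.
  by move=> x /= xs; apply: h; rewrite /= in_cons xs orbT.
have [p1 [p1f p1p p1R]] := h w (mem_head _ _).
exists (p0 `|` p1); split; first by rewrite finite_setU.
  by move=> x [/p0p|/p1p].
move=> a /sat_setU[ap0 ap1] x; rewrite /= in_cons => /orP[/eqP->|xs].
  exact: p1R.
exact: p0R.
Qed.

Definition entailed (W : Type) (c : W -> M) : set (formula L (V + W)) :=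
  [set phi | entails p [set inst c phi]].

Lemma entails_fconj (W : Type) (c : W -> M)
    (s : seq {classic formula L (V + W)}) : [set` s] `<=` entailed c ->
  exists p0, [/\ finite_set p0, p0 `<=` p & forall a, real a p0 ->
    feval (fconj s) (fork a c)].
Proof.
move=> hs; have [|p0 [p0f p0p h]] :=
  @entails_seq _ s (fun phi a => feval phi (fork a c)).
  move=> phi /hs/entails1[p0 [p0f p0p h]].
  by exists p0; split=> // a /h; rewrite feval_inst.
by exists p0; split=> // a ap; rewrite feval_fconj => phi; apply: h.
Qed.

(** A large p need not be realized in the monster. Its generic points over small
    tuples, which play the part of realizations of p|_c, always exist. *)
Definition generic (W : Type) (c : W -> M) (d : V -> M) : Prop :=
  sat (fork d c) (entailed c).

Lemma real_generic (W : Type) (c : W -> M) d : real d p -> generic c d.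
Proof.
by move=> dp phi /entails_real/(_ dp)/(_ _ erefl); rewrite feval_inst.
Qed.

Lemma generic_comp (W W' : Type) (c : W -> M) (h : W' -> W) d :
  generic c d -> generic (c \o h) d.
Proof.
move=> cd phi hphi; rewrite -(fork_sumap d c id h) -feval_rename; apply: cd.
by rewrite /entailed /= -inst_comp.
Qed.

Lemma generic_forkl (W W' : Type) (c : W -> M) (c' : W' -> M) d :
  generic (fork c c') d -> generic c d.
Proof. by move=> cd; exact (generic_comp (h := inl) cd). Qed.

Lemma generic_forkr (W W' : Type) (c : W -> M) (c' : W' -> M) d :
  generic (fork c c') d -> generic c' d.
Proof. by move=> cd; exact (generic_comp (h := inr) cd). Qed.

Lemma generic_real (W : Type) (c : W -> M) d (q : mtype M V) :
  generic c d -> entails p q -> q `<=` range (inst c) -> real d q.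
Proof.
move=> cd pq qc phi /[dup] qphi /qc[psi _ psiE].
by rewrite -psiE feval_inst; apply: cd => _ ->; rewrite psiE; apply: pq.
Qed.

Lemma generic_exists (W : Type) (c : W -> M) :
  consistent p -> small_type V -> small_type W -> exists d, generic c d.
Proof.
move=> pc sV sW; apply: realize => // s /entails_fconj[p0 [p0f p0p h]].
by have [a ap] := pc p0 p0f p0p; exists a; apply: h.
Qed.

(** If this failed, then by saturation a finite part p0 of p would exclude some
    formula chi of the type of (d, u) over c. Then p0 entails
    [~ exists u, chi(x, u, c)], a formula over c that fails at d. *)
Lemma generic_extend (U W W' : Type) (c : W -> M) (c' : W' -> M) d (u : U -> M) :
  small_type V -> small_type U -> small_type W -> small_type W' ->
  generic c d ->
  exists d' (u' : U -> M), generic (fork c c') d' /\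
    forall phi : formula L ((V + U) + W),
      feval phi (fork (fork d u) c) -> feval phi (fork (fork d' u') c).
Proof.
move=> sV sU sW sW' cd.
pose l : V + (W + W') -> (V + U) + (W + W') := sumap inl id.
pose r : (V + U) + W -> (V + U) + (W + W') := sumap id inl.
have [|||a /sat_setU[al ar]] := @realize (V + U) (W + W') (fork c c')
    ([set frename phi l | phi in entailed (fork c c')] `|`
     [set frename phi r | phi in [set phi | feval phi (fork (fork d u) c)]]).
- exact: small_sum.
- exact: small_sum.
- move=> s ss.
  have [sl [sr [hl hr hs]]] :
      exists (sl : seq {classic formula L (V + (W + W'))})
             (sr : seq {classic formula L ((V + U) + W)}),
      [/\ [set` sl] `<=` entailed (fork c c'),
          forall phi, phi \in sr -> feval phi (fork (fork d u) c) &
          forall a : (V + U) + (W + W') -> M, feval (fconj sl) (a \o l) ->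
            feval (fconj sr) (a \o r) -> feval (fconj s) a].
    elim: s ss => [|phi s IH] ss; first by exists [::], [::]; split=> //= a _ _ [].
    have [|sl [sr [hl hr hs]]] := IH.
      by move=> x /= xs; apply: ss; rewrite /= in_cons xs orbT.
    have [[psi hpsi phiE]|[psi hpsi phiE]] := ss phi (mem_head _ _).
      exists (psi :: sl), sr; split=> //.
        by move=> x; rewrite /= in_cons => /orP[/eqP->|/hl].
      move=> a /feval_fand[al asl] asr; apply/feval_fand; split; last exact: hs.
      by rewrite -phiE feval_rename.
    exists sl, (psi :: sr); split=> //.
      by move=> x; rewrite in_cons => /orP[/eqP->|/hr].
    move=> a asl /feval_fand[al asr]; apply/feval_fand; split; last exact: hs.
    by rewrite -phiE feval_rename.
  have [p0 [p0f p0p p0h]] := entails_fconj hl.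
  have [psi psiP] := fex_tuple M (frename (fconj sr) (@rotate V U W)).
  apply: contrapT => nex.
  have : feval (fneg psi) (fork d c).
    apply: cd; apply/entails1; exists p0; split=> // a ap.
    rewrite feval_inst feval_fneg psiP => -[u']; rewrite feval_rename fork_rotate => ar.
    apply: nex; exists (fork a u'); apply: hs.
      by rewrite /l fork_sumap; apply: p0h.
    by rewrite /r fork_sumap.
  rewrite feval_fneg psiP; apply; exists u.
  by rewrite feval_rename fork_rotate feval_fconj.
exists (a \o inl), (a \o inr); split=> [phi|phi hphi].
  by move/sat_rename: al; rewrite /l fork_sumap; apply.
by move/sat_rename: ar; rewrite /r fork_sumap fork_eta; apply.
Qed.

(** Every finite part of q contributes a formula [exists u, q0(x, u)] over c
    entailed by p; saturation realizes all of q at once. *)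
Lemma generic_entails_ex (U W : Type) (c : W -> M) d (q : mtype M (V + U)) :
  small_type V -> small_type U -> small_type W ->
  generic c d -> entails_ex p q -> q `<=` range (inst c) ->
  exists u : U -> M, real (fork d u) q.
Proof.
move=> sV sU sW cd pq qc.
pose rot := @rotate V U W.
pose unrot : U + (V + W) -> (V + U) + M :=
  fork (inl \o inr) (fork (inl \o inl) (inr \o c)).
have unrotK chi : frename (frename chi rot) unrot = inst c chi.
  by rewrite frename_comp; congr frename; apply/funext => -[[]|].
have [|||u /sat_rename] := @realize U (V + W) (fork d c)
    [set frename psi rot | psi in [set psi | q (inst c psi)]].
- exact: sU.
- exact: small_sum.
- move=> s sq; have [psi psiP] := fex_tuple M (fconj s).
  apply/psiP; apply: cd; apply/entails1.
  have [||p0 [p0f p0p p0h]] := pq [set frename phi unrot | phi in [set` s]].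
  + by apply: finite_image; exact: (@finite_seq {classic _}).
  + by move=> _ [phi /sq[chi qchi <-] <-]; rewrite unrotK.
  exists p0; split=> // a /p0h[u' hu'].
  rewrite feval_inst psiP; exists u'; rewrite feval_fconj.
  move=> phi /[dup] phis /sq[chi _ chiE].
  rewrite -chiE feval_rename fork_rotate -feval_inst -unrotK; apply: hu'.
  by exists phi => //; rewrite chiE.
rewrite fork_rotate => uq; exists u => phi /[dup] qphi /qc[psi _ psiE].
by rewrite -psiE feval_inst; apply: uq; rewrite /= psiE.
Qed.

End Generic.
End Monster.

(** * Homomorphisms determined on generic points *)

Section GenericMorphism.
(** [gen] is a proper left-invariant filter on A, given by its members; [N a]
    is the set of points generic over a. *)
Context (A B : Type) (opA : A -> A -> A) (opB : B -> B -> B).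
Context (A_group : group_law opA) (B_group : group_law opB).
Context (gen : set A -> Prop) (S : set A) (N : A -> set A) (f : A -> option B).
Context (gen_exists : forall X, gen X -> exists x, X x).
Context (gen_and : forall X Y, gen X -> gen Y -> gen (X `&` Y)).
Context (gen_mul : forall g X, gen X -> gen [set x | X (opA g x)]).
Context (gen_S : gen S).
Context (gen_N : forall a, gen (N a)).
Context (f_total : forall a, S a -> exists u, f a = Some u).
Context (f_morph : forall a b u v, S a -> N a b ->
  f a = Some u -> f b = Some v -> f (opA a b) = Some (opB u v)).

(** That y = f(g a) f(a)^-1, in a form that is visibly type-definable. *)
Definition quotient_graph (g : A) (y : B) : Prop :=
  exists a u v, [/\ S a, S (opA g a), f a = Some u,
                    f (opA g a) = Some v & opB y u = v].

Lemma quotient_graph_total g : exists y, quotient_graph g y.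
Proof.
have [_ [e [inv [_ idr invl _]]]] := B_group; have [assoc _] := B_group.
have [d [Sd Sgd]] := gen_exists (gen_and gen_S (gen_mul g gen_S)).
have [[u fd] [v fgd]] := (f_total Sd, f_total Sgd).
by exists (opB v (inv u)), d, u, v; split=> //; rewrite -assoc invl idr.
Qed.

(** Given witnesses a and a', put x = a^-1 a'. For d generic and e = x d one has
    a e = a' d and g a e = g a' d. Both sides of each equation are products of
    an element of S by one generic over it, so f may be applied; the values at
    d and e then cancel. *)
Lemma quotient_graph_fun g y y' :
  quotient_graph g y -> quotient_graph g y' -> y = y'.
Proof.
move=> [a [u [v [Sa Sb fa fb yv]]]] [a' [u' [v' [Sa' Sb' fa' fb' yv']]]].
have [assocA [eA [invA [idlA _ _ invrA]]]] := A_group.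
have [assocB [eB [invB [_ idrB _ invrB]]]] := B_group.
pose x := opA (invA a) a'.
have axE d : opA a (opA x d) = opA a' d.
  by rewrite /x !assocA invrA idlA.
have [d [[Sd [Na' Nb']] [Sxd [Na Nb]]]] := gen_exists
  (gen_and (gen_and gen_S (gen_and (gen_N a') (gen_N (opA g a'))))
          (gen_mul x (gen_and gen_S (gen_and (gen_N a) (gen_N (opA g a)))))).
have [[w fd] [z fxd]] := (f_total Sd, f_total Sxd).
have uz : opB u z = opB u' w.
  have := f_morph Sa Na fa fxd.
  by rewrite axE (f_morph Sa' Na' fa' fd) => -[].
have vz : opB v z = opB v' w.
  have := f_morph Sb Nb fb fxd.
  by rewrite -assocA axE assocA (f_morph Sb' Nb' fb' fd) => -[].
have : opB y (opB u z) = opB y' (opB u z).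
  by rewrite assocB yv vz -yv' -assocB uz.
move: (opB u z) => t /(congr1 (opB^~ (invB t))).
by rewrite -!assocB invrB !idrB.
Qed.

(** Multiplicativity at (g, h): for c generic, h c and g h c lie in S and
    f(ghc) f(c)^-1 = f(ghc) f(hc)^-1 f(hc) f(c)^-1. Agreement with f at a in S:
    for d generic over a, f(ad) f(d)^-1 = f(a). *)
Lemma generic_morphism : exists f' : A -> B,
  [/\ {morph f' : a b / opA a b >-> opB a b},
      forall a, S a -> f a = Some (f' a) &
      forall g y, f' g = y <-> quotient_graph g y].
Proof.
have [f' f'P] := choice quotient_graph_total.
have f'E g y : quotient_graph g y -> f' g = y.
  exact/quotient_graph_fun/f'P.
have [assocA _] := A_group; have [assocB _] := B_group.
exists f'; split=> [g h|a Sa|g y].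
- have [c [Sc [Shc Sghc]]] := gen_exists
    (gen_and gen_S (gen_mul h (gen_and gen_S (gen_mul g gen_S)))).
  have [u fc] := f_total Sc; have [v fhc] := f_total Shc.
  have [w fghc] := f_total Sghc.
  have [_ [e [inv [_ idr invl _]]]] := B_group.
  have hE : f' h = opB v (inv u).
    by apply: f'E; exists c, u, v; split=> //; rewrite -assocB invl idr.
  have gE : f' g = opB w (inv v).
    by apply: f'E; exists (opA h c), v, w; split=> //; rewrite -assocB invl idr.
  apply: f'E; exists c, u, w; rewrite -assocA; split=> //.
  by rewrite hE gE -!assocB invl idr invl idr.
- have [d [[Sd Nd] Sad]] := gen_exists
    (gen_and (gen_and gen_S (gen_N a)) (gen_mul a gen_S)).
  have [[u fa] [w fd]] := (f_total Sa, f_total Sd).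
  rewrite fa; congr Some; symmetry; apply: f'E.
  by exists d, w, (opB u w); split=> //; apply: f_morph.
- by split=> [<-|]; [exact: f'P | exact: f'E].
Qed.

Lemma group_cancel (G : Type) (op : G -> G -> G) x y z :
  group_law op -> op x z = op y z -> x = y.
Proof.
move=> [assoc [e [inv [_ idr _ invr]]]] /(congr1 (op^~ (inv z))).
by rewrite -!assoc invr !idr.
Qed.

(** Every g is a quotient of two elements of S, since c and g c lie in S for c
    generic. *)
Lemma morphism_determined (h k : A -> B) :
  {morph h : a b / opA a b >-> opB a b} -> {morph k : a b / opA a b >-> opB a b} ->
  (forall a, S a -> h a = k a) -> h = k.
Proof.
move=> hM kM hk; apply/funext => g.
have [c [Sc Sgc]] := gen_exists (gen_and gen_S (gen_mul g gen_S)).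
apply: (@group_cancel _ _ _ _ (h c) B_group).
by rewrite -hM (hk c Sc) -kM; exact: hk.
Qed.

(** For c generic, x c and y c both lie in S. *)
Lemma morphism_injective (h : A -> B) :
  {morph h : a b / opA a b >-> opB a b} ->
  (forall a b, S a -> S b -> h a = h b -> a = b) -> injective h.
Proof.
move=> hM hI x y hxy.
have [c [Sxc Syc]] := gen_exists (gen_and (gen_mul x gen_S) (gen_mul y gen_S)).
by apply: (@group_cancel _ _ _ _ c A_group); apply: hI => //; rewrite !hM hxy.
Qed.

End GenericMorphism.

(** * Hyperdefinable sets *)

Section Hyperdefinable.
Context (L : language) (T : theory L) (M : monster T).

Lemma over_inst (C : params M) (V : Type) (p : mtype M V) : Defs.over C p ->
  exists h, p = inst (@ptuple L T M C) @` h.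
Proof. by move=> [h [_ _ ->]]; exists h. Qed.

Lemma over_range (C : params M) (V : Type) (p : mtype M V) : Defs.over C p ->
  p `<=` range (inst (@ptuple L T M C)).
Proof. by move=> /over_inst[h ->]; exact: image_subset. Qed.

Section Elements.
Context (P : quot M) (P_eq : quot_equivalence P).

Lemma reps_exists (m : elt P) : exists a, reps m a.
Proof.
have [refl _ _ _] := P_eq.
by case: m => A [a [adom AE]]; exists a; rewrite /reps /= AE; exact: refl.
Qed.

Lemma reps_rel (m : elt P) a b : reps m a ->
  reps m b <-> real (fork a b) (qeq P).
Proof.
have [refl dom sym trans] := P_eq.
case: m => A [c [cdom AE]]; rewrite /reps /= AE /= => ca.
by split=> [/(trans _ _ _ (sym _ _ ca))|/(trans _ _ _ ca)].
Qed.

Lemma reps_dom (m : elt P) a : reps m a -> real a (qdom P).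
Proof.
have [refl dom sym trans] := P_eq => /[dup] ma /(reps_rel _ ma).
by move=> /dom[].
Qed.

Lemma reps_inj (m n : elt P) a : reps m a -> reps n a -> m = n.
Proof.
move=> ma na; have : reps m = reps n.
  by apply/seteqP; split=> b; rewrite (reps_rel b ma) (reps_rel b na).
case: m {ma} => A Ap; case: n {na} => B Bp /= AB.
exact: eq_exist.
Qed.

Lemma elt_exists a : real a (qdom P) -> exists m : elt P, reps m a.
Proof.
move=> adom; have [refl _ _ _] := P_eq.
exists (exist _ [set b | real (fork a b) (qeq P)] (ex_intro _ a (conj adom erefl))).
exact: refl.
Qed.

Lemma type_on_reps (p : mtype M (qvar P)) (m : elt P) a b :
  type_on p -> reps m a -> reps m b -> real a p -> real b p.
Proof.
move=> [_ p_inv] ma /(reps_rel _ ma) ab ap.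
have := @entails_real _ _ _ _ _ _ (fork a b) p_inv.
rewrite real_ren; apply; apply/sat_setU; split=> //; exact/real_ren.
Qed.

End Elements.

Lemma type_on_prod_reps (P Q : quot M) (p : mtype M (qvar P + qvar Q))
    (m : elt P) (n : elt Q) a a' b b' :
  quot_equivalence P -> quot_equivalence Q -> @type_on L T M (quot_prod P Q) p ->
  reps m a -> reps m a' -> reps n b -> reps n b' ->
  real (fork a b) p -> real (fork a' b') p.
Proof.
move=> Peq Qeq [_ p_inv] ma /(reps_rel Peq _ ma) aa' nb /(reps_rel Qeq _ nb) bb' ap.
have := @entails_real _ _ _ _ _ _ (fork (fork a b) (fork a' b')) p_inv.
rewrite real_ren; apply; apply/sat_setU; split; first exact/real_ren.
by apply/sat_setU; split; apply/real_ren; rewrite fork_sumap.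
Qed.

Section TypeDefinable.
Context (C : params M).
Local Notation cs := (@ptuple L T M C).

(** The condition under which g(x, (c_i)_i) depends on the hyperimaginaries c_i
    and not on their chosen representatives. *)
Definition invariant_type (V : Type) (g : set (formula L (V + pvar C))) : Prop :=
  (forall x y, sat (fork x y) g ->
     forall i, real (pcoord y i) (qdom (hsort (pelt i)))) /\
  (forall x y y',
     (forall i, real (fork (pcoord y i) (pcoord y' i)) (qeq (hsort (pelt i)))) ->
     sat (fork x y) g -> sat (fork x y') g).

Lemma type_definableP (V : Type) (D : set (V -> M)) :
  type_definable C D <->
  exists g, invariant_type g /\ forall x, D x <-> sat (fork x cs) g.
Proof.
split=> [[_ [[g [g1 g2 ->]] ->]]|[g [[g1 g2] gD]]].
  by exists g; split=> // x; rewrite -real_inst.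
exists (inst cs @` g); split; first by exists g; split.
by apply/seteqP; split=> x /=; rewrite gD real_inst.
Qed.

Lemma type_definableI (V : Type) (D E : set (V -> M)) :
  type_definable C D -> type_definable C E -> type_definable C (D `&` E).
Proof.
move=> /type_definableP[g [[g1 g2] gD]] /type_definableP[k [[k1 k2] kE]].
apply/type_definableP; exists (g `|` k); split; last first.
  by move=> x; rewrite sat_setU -gD -kE.
split=> [x y /sat_setU[/g1 //]|x y y' yy' /sat_setU[xg xk]].
by apply/sat_setU; split; [exact: g2 yy' xg|exact: k2 yy' xk].
Qed.

Lemma type_definable_preim (V W : Type) (h : V -> W) (D : set (V -> M)) :
  type_definable C D -> type_definable C [set a : W -> M | D (a \o h)].
Proof.
move=> /type_definableP[g [[g1 g2] gD]].
have satE x y : sat (fork x y) [set frename phi (sumap h id) | phi in g] <->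
    sat (fork (x \o h) y) g by rewrite sat_rename fork_sumap.
apply/type_definableP; exists [set frename phi (sumap h id) | phi in g].
split=> [|x]; last by rewrite satE -gD.
split=> [x y /satE/g1 //|x y y' yy' /satE xg].
by apply/satE; apply: g2 yy' xg.
Qed.

Lemma type_definable_ex (V U : Type) (D : set (V + U -> M)) :
  small_type M V -> small_type M U -> type_definable C D ->
  type_definable C [set a : V -> M | exists u, D (fork a u)].
Proof.
move=> sV sU /type_definableP[g [[g1 g2] gD]].
have [k kP] := type_ex [set frename phi (@rotate V U (pvar C)) | phi in g] sU
  (small_sum sV (pelt_small C)).
have satE (x : V -> M) y : sat (fork x y) k <-> exists u, sat (fork (fork x u) y) g.
  by rewrite kP; split=> -[u] ug; exists u; move: ug; rewrite sat_rename fork_rotate.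
apply/type_definableP; exists k; split=> [|x].
  split=> [x y /satE[u /g1 //]|x y y' yy' /satE[u xg]].
  by apply/satE; exists u; apply: g2 yy' xg.
by rewrite satE; split=> -[u]; [rewrite gD|rewrite -gD]; exists u.
Qed.

(** pi|_C is a union of types over C. Intersecting with a set already
    type-definable over C supplies the membership of the parameters in their
    sorts, which an empty union would lack. *)
Lemma type_definable_restr (P : quot M) (pi : mtype M (qvar P)) D :
  type_definable C D -> type_definable C (D `&` [set a | real a (restr C pi)]).
Proof.
move=> /type_definableP[g [[g1 g2] gD]].
pose k : set (formula L (qvar P + pvar C)) := [set psi | exists h,
  [/\ invariant_type h, type_on (inst cs @` h), entails pi (inst cs @` h) & h psi]].
apply/type_definableP; exists (g `|` k); split.
  split=> [x y /sat_setU[/g1 //]|x y y' yy' /sat_setU[xg xk]].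
  apply/sat_setU; split; first exact: g2 yy' xg.
  move=> psi /[dup] kpsi [h [[h1 h2] hon hpi hpsi]].
  apply: (h2 x y y' yy') hpsi => phi hphi; apply: xk.
  by exists h; split.
move=> x; rewrite sat_setU -gD; split=> -[xD xr]; split=> //.
  move=> psi [h [[h1 h2] hon hpi hpsi]]; rewrite -feval_inst; apply: xr.
  by exists (inst cs @` h); split=> //; exists h; split.
move=> _ [_ [[h [h1 h2 ->]] hon hpi [psi hpsi <-]]].
by rewrite feval_inst; apply: xr; exists h; split.
Qed.

End TypeDefinable.
End Hyperdefinable.

(** * The filter of generic properties of a group *)

Section GenericFilter.
Context (L : language) (T : theory L) (M : monster T).
Context (C : params M) (P : quot M) (op : elt P -> elt P -> elt P).
Context (G_group : hyperdefinable_group C op).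
Context (pi : mtype M (qvar P)).
Context (pi_consistent : consistent pi) (pi_on_G : type_on pi).
Context (pi_invariant : left_invariant op pi).

Local Notation V := (qvar P).
Local Notation cs := (@ptuple L T M C).

Let sV : small_type M V. Proof. by case: G_group => -[]. Qed.
Let sC : small_type M (pvar C). Proof. exact: pelt_small. Qed.
Let P_eq : quot_equivalence P. Proof. by case: G_group => -[]. Qed.

Definition generically (X : set (elt P)) : Prop :=
  exists (W : Type) (c : W -> M), small_type M W /\
    forall d m, generic pi c d -> reps m d -> X m.

Lemma generic_dom d : generic pi cs d -> real d (qdom P).
Proof.
move=> cd; have [[_ P_dom _ _ _] _ _] := G_group.
by apply: (generic_real cd) (over_range P_dom); exact: pi_on_G.1.
Qed.

Lemma generically_exists X : generically X -> exists x, X x.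
Proof.
move=> [W [c [sW cX]]].
have [d cd] := generic_exists (fork c cs) pi_consistent sV (small_sum sW sC).
have [m md] := elt_exists P_eq (generic_dom (generic_forkr cd)).
by exists m; apply: cX md; exact: generic_forkl cd.
Qed.

Lemma generically_and X Y : generically X -> generically Y -> generically (X `&` Y).
Proof.
move=> [W [c [sW cX]]] [W' [c' [sW' cY]]].
exists (W + W')%type, (fork c c'); split; first exact: small_sum.
move=> d m cd md; split; first exact: cX (generic_forkl cd) md.
exact: cY (generic_forkr cd) md.
Qed.

Lemma generically_restr : generically [set m | realizes m (restr C pi)].
Proof.
exists (pvar C), cs; split=> // d m cd md; exists d => // phi.
move=> [g [/over_range gC _ pig gphi]].
by have := generic_real cd pig gC; apply.
Qed.

(** A type g(x, b) in pi|_(C,n) may involve any representative b of n, and these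
    do not fit into a small tuple; so a point d generic over C and one
    representative b0 has to satisfy g(x, b). As g is invariant, g(x, b0) will
    do. If it failed at d, it would fail at some d' generic over b too
    ([generic_extend]); but d' satisfies g(x, b), hence g(x, b0). *)
Lemma generically_restr1 (Q : quot M) (n : elt Q) :
  quot_equivalence Q -> small_type M (qvar Q) ->
  generically [set m | realizes m (restr1 C pi n)].
Proof.
move=> Q_eq sQ; have [b0 nb0] := reps_exists Q_eq n.
exists (qvar Q + pvar C)%type, (fork b0 cs); split; first exact: small_sum.
move=> d m cd md; exists d => // phi [g [b [gC gon nb pig gphi]]].
suff dg : real (fork d b) g by apply: ((real_plug b g d).2 dg).
apply: (type_on_prod_reps P_eq Q_eq gon md md nb0 nb).
have [h gE] := over_inst gC; rewrite gE real_inst => psi hpsi.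
apply: contrapT => npsi.
pose k : (V + qvar Q) + pvar C -> (V + void) + (qvar Q + pvar C) :=
  fork (fork (inl \o inl) (inr \o inl)) (inr \o inr).
have kE (x : V -> M) (y : qvar Q -> M) (z : pvar C -> M) :
    fork (fork x (of_void M)) (fork y z) \o k = fork (fork x y) z.
  by apply/funext => -[[]|].
have [d' [u' [cd' tp]]] :=
  generic_extend b (of_void M) sV (small_void M) (small_sum sQ sC) sQ cd.
have u'E : u' = of_void M by apply/funext => -[].
have := tp (frename (fneg psi) k).
rewrite !feval_rename u'E !kE !feval_fneg => /(_ npsi); apply.
have [m' m'd'] := elt_exists P_eq (generic_dom (generic_forkr (generic_forkl cd'))).
suff : real (fork d' b0) g by rewrite gE real_inst; apply.
apply: (type_on_prod_reps P_eq Q_eq gon m'd' m'd' nb nb0).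
apply/real_plug; apply: (generic_real cd' pig) => _ [chi + <-].
rewrite gE => -[chi0 _ <-].
exists (frename chi0 (fork (sumap id inr) (inr \o inl \o inr))) => //.
rewrite /inst !frename_comp; congr frename.
by apply/funext => -[[]|].
Qed.

(** Each formula psi of the pushforward comes from small types Gr and q with
    parameters of its own. At d generic over these, [generic_entails_ex] yields
    a representative of g d realizing q, and by invariance of q every
    representative of g d does. The tuple c depends on s, which is why s is a
    finite list: the cofinality of the monster's cardinal may be small. *)
Lemma translate_pushforward (g : elt P) (s : seq {classic formula L (V + M)}) :
  (forall psi, psi \in s ->
     pushforward (fun h => Some (op g h)) pi psi) ->
  exists (W : Type) (c : W -> M), small_type M W /\
    forall d u m, generic pi c d -> reps m d -> reps (op g m) u ->
    forall psi, psi \in s -> feval psi (fork u id).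
Proof.
elim: s => [|psi s IH] sg.
  exists void, (of_void M); split=> //.
  exact: small_void.
have [|W [c [sW cs']]] := IH.
  by move=> x xs; apply: sg; rewrite in_cons xs orbT.
have [Gr [q [sG Gg sq qon [piq qpsi]]]] := sg psi (mem_head _ _).
have [W1 [c1 [sW1 c1G]]] := small_params sG.
have [W2 [c2 [sW2 c2q]]] := small_params sq.
exists (W + (W1 + W2))%type, (fork c (fork c1 c2)); split.
  by do 2?apply: small_sum.
move=> d u m cd md gmu x; rewrite in_cons => /orP[/eqP->|xs]; last first.
  exact: cs' (generic_forkl cd) md gmu _ xs.
have [|u' /sat_setU[dG /real_ren u'q]] :=
  generic_entails_ex sV sV (small_sum sW1 sW2) (generic_forkr cd) piq.
  move=> phi [/c1G[chi _ <-]|[_ /c2q[chi _ <-] <-]].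
    by exists (frename chi (sumap id inl)); rewrite // -inst_comp.
  exists (frename chi (sumap inr inr)) => //.
  by rewrite /inst !frename_comp; congr frename; apply/funext => -[].
have [m' [n [m'd nu' [nE]]]] := (Gg d u').1 dG.
rewrite (reps_inj P_eq m'd md) in nE; rewrite -nE in nu'.
by have := type_on_reps P_eq qon nu' gmu u'q; apply.
Qed.

(** A formula phi over c entailed by pi holds at g d' whenever d' is generic over
    a tuple c' depending on phi. If it failed at g d, where d is only generic
    over c, g and C, one could move (d, g d) within its type over c, g and C so
    that d becomes generic over c' as well, a contradiction. *)
Lemma generic_translate (W : Type) (c : W -> M) (g : elt P) g0 d m u :
  small_type M W -> reps g g0 ->
  generic pi (fork c (fork g0 cs)) d -> reps m d -> reps (op g m) u -> generic pi c u.
Proof.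
move=> sW gg0 cd md gmu phi phi_ent.
have [s [sg s_phi]] : exists s : seq {classic formula L (V + M)},
    (forall psi, psi \in s -> pushforward (fun h => Some (op g h)) pi psi) /\
    forall a, (forall psi, psi \in s -> feval psi (fork a id)) ->
      feval phi (fork a c).
  have [p0 [/finite_set_seq[s ->] p0p p0phi]] := (entails1 _ _).1 phi_ent.
  have [|p1 [/finite_set_seq[t ->] p1p p1h]] := @entails_seq _ _ _ _
      (pushforward (fun h => Some (op g h)) pi) _ s
      (fun psi a => feval psi (fork a id)).
    by move=> psi /p0p/((pi_invariant g).1 psi).
  exists t; split=> // a at_.
  by rewrite -feval_inst; apply: p0phi; exact: p1h.
have [W' [c' [sW' c'P]]] := translate_pushforward sg.
apply: contrapT => nphi.
have sE : small_type M (W + (V + pvar C)) by do 2?apply: small_sum.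
have [d' [u' [cd' tp]]] := generic_extend c' u sV sV sE sW' cd.
have [_ _ [p [/over_inst[h ->] opE]]] := G_group.
have opP (x y z : V -> M) : sat (fork (fork (fork x y) z) cs) h <->
    exists m n, [/\ reps m x, reps n y & reps (op m n) z].
  rewrite -real_inst; move/seteqP: opE => [h1 h2].
  split=> [/h2 //|opxyz]; exact: (h1 (fork (fork x y) z) opxyz).
(* u' still represents the product of g by the class of d'. *)
have : sat (fork (fork (fork g0 d') u') cs) h.
  have : sat (fork (fork (fork g0 d) u) cs) h by apply/opP; exists g, m.
  pose k : ((V + V) + V) + pvar C -> (V + V) + (W + (V + pvar C)) :=
    fork (fork (fork (inr \o inr \o inl) (inl \o inl)) (inl \o inr))
         (inr \o inr \o inr).
  have kE (x y : V -> M) :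
      fork (fork x y) (fork c (fork g0 cs)) \o k = fork (fork (fork g0 x) y) cs.
    by apply/funext => -[[[]|]|].
  move=> hd psi hpsi; rewrite -kE -feval_rename; apply: tp.
  by rewrite feval_rename kE; exact: hd.
move=> /opP[g' [m' [g'g0 m'd' gmu']]].
rewrite (reps_inj P_eq g'g0 gg0) in gmu'.
pose k : V + W -> (V + V) + (W + (V + pvar C)) :=
  fork (inl \o inr) (inr \o inl).
have kE (x y : V -> M) :
    fork (fork x y) (fork c (fork g0 cs)) \o k = fork y c.
  by apply/funext => -[].
have := tp (frename (fneg phi) k).
rewrite !feval_rename !kE !feval_fneg => /(_ nphi); apply.
apply: s_phi; exact: c'P (generic_forkr cd') m'd' gmu'.
Qed.

Lemma generically_mul g X : generically X -> generically [set m | X (op g m)].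
Proof.
move=> [W [c [sW cX]]]; have [g0 gg0] := reps_exists P_eq g.
exists (W + (V + pvar C))%type, (fork c (fork g0 cs)).
split=> [|d m cd md]; first by do 2?apply: small_sum.
have [u gmu] := reps_exists P_eq (op g m).
exact: cX (generic_translate sW gg0 cd md gmu) gmu.
Qed.

End GenericFilter.

(** * The theorem *)

(** The graph of f' projects the set of all (x, y, s, t, u, v) with s, t in
    pi|_C, t = x s, v = y u, u = f(s) and v = f(t). *)
Lemma quotient_graph_type_definable (L : language) (T : theory L)
    (M : monster T) (C : params M) (P Q : quot M)
    (opG : elt P -> elt P -> elt P) (opH : elt Q -> elt Q -> elt Q)
    (pi : mtype M (qvar P)) (f : elt P -> option (elt Q)) (f' : elt P -> elt Q) :
  hyperdefinable_group C opG -> hyperdefinable_group C opH ->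
  type_definable_fun C f ->
  (forall g y, f' g = y <->
     quotient_graph opG opH [set m | realizes m (restr C pi)] f g y) ->
  type_definable_fun C (fun a => Some (f' a)).
Proof.
move=> [[sP P_dom _ _ P_eq] G_law G_def] [[sQ _ _ _ Q_eq] H_law H_def].
move=> [Gr [Gr_over Gr_graph]] f'graph.
pose U := ((qvar P + qvar P) + (qvar Q + qvar Q))%type.
pose Z := ((qvar P + qvar Q) + U)%type.
pose x : qvar P -> Z := inl \o inl.
pose y : qvar Q -> Z := inl \o inr.
pose s : qvar P -> Z := inr \o inl \o inl.
pose t : qvar P -> Z := inr \o inl \o inr.
pose u : qvar Q -> Z := inr \o inr \o inl.
pose v : qvar Q -> Z := inr \o inr \o inr.
have GrP z : real z Gr <->
    exists m n, [/\ reps m (z \o inl), reps n (z \o inr) & f m = Some n].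
  by rewrite -{1}(fork_eta z).
have Gr_def : type_definable C [set a | real a Gr] by exists Gr.
have S_def : type_definable C
    ([set a | real a (qdom P)] `&` [set a | real a (restr C pi)]).
  by apply: type_definable_restr; exists (qdom P).
have sPQ : small_type M (qvar P + qvar Q) by exact: small_sum.
have sU : small_type M U by do 2?apply: small_sum.
have := type_definable_ex sPQ sU
  (type_definableI (type_definable_preim (fork (fork x s) t) G_def)
  (type_definableI (type_definable_preim (fork (fork y u) v) H_def)
  (type_definableI (type_definable_preim (fork s u) Gr_def)
  (type_definableI (type_definable_preim (fork t v) Gr_def)
  (type_definableI (type_definable_preim s S_def)
                   (type_definable_preim t S_def)))))).
move=> [R [R_over /seteqP[R1 R2]]]; exists R; split=> // a b; split.
  move=> /R2[w [[m [n [ma ns mnt]]] [[k [l [kb lu klv]]]]]].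
  move=> [/GrP[n1 [l1 [n1s l1u fn1]]] [/GrP[o [o1 [ot o1v fo]]]]].
  move=> [[_ rs] [_ rt]].
  exists m, k; split=> //; congr Some; apply/f'graph.
  rewrite (reps_inj P_eq n1s ns) (reps_inj Q_eq l1u lu) in fn1.
  rewrite (reps_inj P_eq ot mnt) (reps_inj Q_eq o1v klv) in fo.
  exists n, l, (opH k l); split=> //.
    by exists (w \o inl \o inl).
  by exists (w \o inl \o inr).
move=> [m [n [ma nb [/f'graph[k [l [o [Sk Smk fk fmk nl]]]]]]]].
have [s0 ks0 rs0] := Sk; have [t0 kt0 rt0] := Smk.
have [u0 lu0] := reps_exists Q_eq l; have [v0 ov0] := reps_exists Q_eq o.
apply: R1; exists (fork (fork s0 t0) (fork u0 v0)).
split; first by exists m, k.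
split; first by exists n, l; split=> //; rewrite nl.
split; first by apply/GrP; exists k, l.
split; first by apply/GrP; exists (opG m k), o.
split; first by split; [exact: (reps_dom P_eq ks0) | exact: rs0].
by split; [exact: (reps_dom P_eq kt0) | exact: rt0].
Qed.

Theorem theorem4p19 (L : language) (T : theory L) (T_complete : complete T)
    (M : monster T) (C : params M) (P Q : quot M)
    (opG : elt P -> elt P -> elt P) (opH : elt Q -> elt Q -> elt Q)
    (G_group : hyperdefinable_group C opG)
    (H_group : hyperdefinable_group C opH)
    (pi : mtype M (qvar P))
    (pi_consistent : consistent pi)
    (pi_on_G : type_on pi)
    (pi_invariant : left_invariant opG pi)
    (pi_type_definable : type_definable_type C pi)
    (f : elt P -> option (elt Q))
    (f_type_definable : type_definable_fun C f)
    (f_defined : defined_on f (restr C pi))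
    (f_morph : forall (a b : elt P) (u v : elt Q),
        realizes a (restr C pi) -> realizes b (restr1 C pi a) ->
        f a = Some u -> f b = Some v -> f (opG a b) = Some (opH u v)) :
  exists f' : elt P -> elt Q,
    unique (fun h : elt P -> elt Q =>
      [/\ type_definable_fun C (fun a => Some (h a)),
          {morph h : a b / opG a b >-> opH a b}
        & forall a, realizes a (restr C pi) -> f a = Some (h a)]) f' /\
    ((forall a b : elt P, realizes a (restr C pi) -> realizes b (restr C pi) ->
        f a = f b -> a = b) ->
     injective f').
Proof.
have [[sP P_dom _ _ P_eq] G_law opG_def] := G_group.
have [[sQ _ _ _ Q_eq] H_law opH_def] := H_group.
have f_total a : realizes a (restr C pi) -> exists u, f a = Some u.
  move=> [d ad dpi]; have [Gr [sG Gf piG]] := f_defined.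
  have [W [c [sW cG]]] := small_params sG.
  have [u /Gf[m [n [md nu fm]]]] := generic_entails_ex sP sQ sW (real_generic dpi) piG cG.
  by exists n; rewrite (reps_inj P_eq ad md).
have evN a := generically_restr1 G_group pi_on_G a P_eq sP.
have evS := generically_restr C pi.
have evE := generically_exists G_group pi_consistent pi_on_G.
have evI := @generically_and _ _ _ _ pi.
have evM := generically_mul G_group pi_invariant.
have [f' [f'M f'f f'graph]] :=
  generic_morphism G_law H_law evE evI evM evS evN f_total f_morph.
exists f'; split; last first.
  move=> f_inj; apply: (morphism_injective G_law evE evI evM evS f'M).
  by move=> a b Sa Sb ab; apply: f_inj => //; rewrite !f'f // ab.
split; last first.
  move=> h [_ hM hf]; apply: (morphism_determined H_law evE evI evM evS) => //.
  by move=> a Sa; have := f'f a Sa; rewrite (hf a Sa) => -[].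
split=> //; exact: quotient_graph_type_definable f'graph.
Qed.
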